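(* Let $(X,d)$ be a finite metric space with at least two points, let $p\in[1,2]$, and let $Y$ be a $p$-smooth Banach space. Then $$c_Y(X,d)\ \ge\ \frac{1}{2^{1-1/p}\cdot S_p(Y)\,\ell_p(X,d)}\left(\frac{1}{|X|^2}\sum_{x,y\in X}d(x,y)^p\right)^{1/p}.$$ In particular, for every $2\le q<\infty$, $$c_q(X,d)\ \ge\ \frac{1}{\ell(X,d)\sqrt{2q-2}}\left(\frac{1}{|X|^2}\sum_{x,y\in X}d(x,y)^2\right)^{1/2}.$$
   Context: $\ell_p$ length: for a finite metric space $(X,d)$ and $p\ge1$, $\ell_p(X,d)$ is the least (infimal) $\ell$ for which there is a sequence of partitions $P^0,P^1,\ldots,P^N$ of $X$ such that: (1) for every $i\ge1$, $P^i$ is a refinement of $P^{i-1}$; (2) $P^0=\{X\}$ and $P^N=\{\{x\}:x\in X\}$; (3) for every $i\ge1$ there exists $a_i>0$ such that whenever $A\in P^{i-1}$ and $B,C\in P^i$ satisfy $B,C\subseteq A$, there is a one-to-one onto function $\phi:B\to C$ with $d(x,\phi(x))\le a_i$ for every $x\in B$; (4) $\ell=\left(\sum_{i=1}^N a_i^p\right)^{1/p}$. One writes $\ell(X,d)=\ell_2(X,d)$. Smoothness: for $p\in[1,2]$, a Banach space $Y$ is $p$-smooth with constant $S$ if $\|x+y\|_Y^p+\|x-y\|_Y^p\le 2\|x\|_Y^p+2S^p\|y\|_Y^p$ for all $x,y\in Y$; the least such $S$ is denoted $S_p(Y)$, and $Y$ is $p$-smooth if $S_p(Y)<\infty$. Distortion: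 for metric spaces $(X,d_X),(Y,d_Y)$ and $f:X\to Y$, $\|f\|_{\mathrm{Lip}}=\sup_{x\ne y} d_Y(f(x),f(y))/d_X(x,y)$. If $f$ is one-to-one, $\mathrm{dist}(f)=\|f\|_{\mathrm{Lip}}\cdot\|f^{-1}\|_{\mathrm{Lip}}$ (with $f^{-1}$ defined on $f(X)$); otherwise $\mathrm{dist}(f)=\infty$. $c_Y(X)=\inf\{\mathrm{dist}(f): f:X\to Y\}$, and $c_q(X)=c_{L_q}(X)$, where $L_q=L_q([0,1])$. *)

(* Defs.v *)
From HB Require Import structures.
From mathcomp Require Import all_boot all_order all_algebra.
From mathcomp Require Import all_classical all_reals all_analysis.
From mathcomp Require Import measurable_realfun.
Import Order.TTheory GRing.Theory Num.Theory.
Import numFieldNormedType.Exports.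

Set Implicit Arguments.
Unset Strict Implicit.
Unset Printing Implicit Defensive.

Local Open Scope classical_set_scope.
Local Open Scope ring_scope.

#[short(type="finMetricType")]
HB.structure Definition FinMetric (R : numDomainType) :=
  { M of Finite M & Metric R M }.

Section distortion.
Context {R : realType}.
Local Open Scope ereal_scope.

Section maps.
Context {X Y : metricType R} (f : X -> Y).

(* The supremum of the empty set is -oo, so that this is the usual notion only
   when the domain has at least two points. *)
Definition lip_norm : \bar R :=
  ereal_sup [set t | exists x y : X,
    x != y /\ t = (mdist (f x) (f y) / mdist x y)%:E].

(* The Lipschitz norm of the inverse of f, defined on the range of f, for an
   injective f: u = f x and v = f y range over the distinct points of the
   range, and f^-1 u = x, f^-1 v = y. *)
Definition inv_lip_norm : \bar R :=
  ereal_sup [set t | exists x y : X,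
    f x != f y /\ t = (mdist x y / mdist (f x) (f y))%:E].

Definition distortion : \bar R :=
  if `[< injective f >] then lip_norm * inv_lip_norm else +oo.

End maps.

(* c_Y(X) *)
Definition least_distortion (Y X : metricType R) : \bar R :=
  ereal_inf [set distortion f | f in [set: X -> Y]].

End distortion.

(* A copy of a normed space, carrying the metric induced by the norm. *)
Section normed_metric.
Context {R : realType}.

Definition normed_metric (Y : normedModType R) : Type := Y.

Variable Y : normedModType R.

HB.instance Definition _ := PseudoMetric.copy (normed_metric Y) Y.

Definition norm_dist (x y : normed_metric Y) : R := `|(x : Y) - (y : Y)|.

Let norm_dist_ge0 x y : 0 <= norm_dist x y.
Proof. exact: normr_ge0. Qed.

Let norm_dist_positivity x y : norm_dist x y = 0 -> x = y.
Proof. by move/normr0_eq0/eqP; rewrite subr_eq0 => /eqP. Qed.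

Let ball_norm_dist (x : normed_metric Y) (e : R) :
  ball x e = [set y | norm_dist x y < e].
Proof. by rewrite -[LHS]/(ball (x : Y) e) -ball_normE. Qed.

HB.instance Definition _ := PseudoMetric_isMetric.Build R (normed_metric Y)
  norm_dist_ge0 norm_dist_positivity ball_norm_dist.

End normed_metric.

Section smoothness.
Context {R : realType}.
Variables (p : R) (Y : completeNormedModType R).

Definition p_smooth_with (S : R) : Prop :=
  forall x y : Y, `|x + y| `^ p + `|x - y| `^ p
                  <= 2 * `|x| `^ p + 2 * S `^ p * `|y| `^ p.

(* S_p(Y) *)
Definition p_smooth_const : \bar R :=
  ereal_inf [set S%:E | S in [set S : R | 0 <= S /\ p_smooth_with S]].

Definition p_smooth : Prop := (p_smooth_const < +oo)%E.

End smoothness.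

Section length.
Context {R : realType}.
Variables (p : R) (X : finMetricType R).

Definition refines (P Q : {set {set X}}) : Prop :=
  forall B, B \in P -> exists2 A, A \in Q & B \subset A.

(* B and C are matched by a bijection moving points by at most a; phi is
   relevant on B only. *)
Definition matched (a : R) (B C : {set X}) : Prop :=
  exists phi : X -> X,
    [/\ {in B &, injective phi},
        (phi @: B)%SET = C
      & forall x, x \in B -> mdist x (phi x) <= a].

(* Only the values P 0, ..., P N and a 1, ..., a N are relevant. *)
Definition admissible (N : nat) (P : nat -> {set {set X}}) (a : nat -> R) :
    Prop :=
  [/\ forall i, (i <= N)%N -> finset.partition (P i) [set: X]%SET,
      forall i, (1 <= i <= N)%N -> refines (P i) (P i.-1),
      P 0%N = [set [set: X]%SET]%SET,
      P N = [set [set x]%SET | x : X]%SET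
    & forall i, (1 <= i <= N)%N -> 0 < a i /\
        forall A B C, A \in P i.-1 -> B \in P i -> C \in P i ->
          B \subset A -> C \subset A -> matched (a i) B C].

Definition lp_length : R :=
  inf [set l | exists N P a, admissible N P a /\
    l = (\sum_(1 <= i < N.+1) a i `^ p) `^ p^-1].

End length.

(* L_p(mu) as a metric space; its points are the classes of functions modulo
   equality almost everywhere. *)
Section Lspace_metric.
Context {d : measure_display} {T : measurableType d} {R : realType}.
Context {mu : {measure set T -> \bar R}} {p : \bar R} {p1 : (1 <= p)%E}.
Local Notation L := (LspaceType mu p1).

HB.instance Definition _ := gen_eqMixin L.
HB.instance Definition _ := gen_choiceMixin L.

Definition Lspace_dist (f g : L) : R :=
  fine ('N[mu]_p [EFin \o ((f : T -> R) \- (g : T -> R))%R])%E.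

Let Lspace_measurable (f : L) : measurable_fun [set: T] (f : T -> R).
Proof. exact: (measurable_funPT (repr (LebesgueSpace.sort f))). Qed.

Let Lspace_measurableB (f g : L) :
  measurable_fun [set: T] ((f : T -> R) \- (g : T -> R)).
Proof. exact: measurable_funB. Qed.

Let Lspace_distE (f g : L) : (Lspace_dist f g)%:E =
  ('N[mu]_p [EFin \o ((f : T -> R) \- (g : T -> R))%R])%E.
Proof.
rewrite fineK// ge0_fin_numE ?Lnorm_ge0//.
rewrite (_ : _ \- _ = (f : T -> R) \+ (\- (g : T -> R)))//.
apply: le_lt_trans (eminkowski mu _ _ p1) _ => //.
  exact: measurableT_comp.
rewrite (_ : EFin \o (\- (g : T -> R)) = (\- (EFin \o (g : T -> R)))%E)//.
rewrite oppe_Lnorm.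
by apply: lte_add_pinfty; exact: Lebesgue_finite.
Qed.

Let Lspace_distxx f : Lspace_dist f f = 0.
Proof.
apply: EFin_inj; rewrite Lspace_distE (_ : _ \o _ = cst 0%E).
  by rewrite Lnorm0// gt_eqF// (lt_le_trans lte01 p1).
by apply/funext => t /=; rewrite subrr.
Qed.

Let Lspace_dist_positivity f g : Lspace_dist f g = 0 -> f = g.
Proof.
move=> fg0; have : ((Lspace_dist f g)%:E = 0)%E by rewrite fg0.
rewrite Lspace_distE => /Lnorm_eq0_eq0 fg.
have {}fg : (f : T -> R) = g %[ae mu].
  have : EFin \o ((f : T -> R) \- (g : T -> R)) = \0%E %[ae mu].
    apply: fg; last exact: (lt_le_trans lte01 p1).
    exact/measurable_EFinP.
  apply: filterS => t /(_ I) /= /eqP; rewrite eqe subr_eq0.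
  by move=> /eqP fgt _.
have {fg} : LebesgueSpace.sort f = LebesgueSpace.sort g.
  have /eqP := introT (ae_eqP (LebesgueSpace.sort f) (LebesgueSpace.sort g)) fg.
  by rewrite !reprK.
case: f g {fg0} => [f [[f1]]] [g [[g1]]] /= fg.
by case: _ / fg g1 => g1; rewrite (bool_irrelevance f1 g1).
Qed.

Let Lspace_dist_sym f g : Lspace_dist f g = Lspace_dist g f.
Proof.
apply: EFin_inj; rewrite !Lspace_distE -oppe_Lnorm; apply: eq_Lnorm => t /=.
by rewrite opprB.
Qed.

Let Lspace_dist_triangle g f h :
  Lspace_dist f h <= Lspace_dist f g + Lspace_dist g h.
Proof.
rewrite -lee_fin EFinD !Lspace_distE.
apply: le_trans (eminkowski mu _ _ p1) => //.
rewrite le_eqVlt; apply/orP; left; apply/eqP/eq_Lnorm => t /=.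
by rewrite addrA subrK.
Qed.

HB.instance Definition _ := isMetric.Build R L
  Lspace_distxx Lspace_dist_positivity Lspace_dist_sym Lspace_dist_triangle.

End Lspace_metric.

(* L_q([0,1]), for real-valued functions. *)
Definition Lq01 (R : realType) (q : R) (q1 : (1 <= q%:E)%E) : metricType R :=
  LspaceType (mrestr (@lebesgue_measure R) (measurable_itv `[0, 1])) q1.

(* Main.v *)
Require Import Defs.
From HB Require Import structures.
From mathcomp Require Import all_boot all_order all_algebra.
From mathcomp Require Import all_classical all_reals all_analysis.
From mathcomp Require Import ring lra measurable_realfun.
Import Order.TTheory GRing.Theory Num.Theory.
Import numFieldNormedType.Exports.

Set Implicit Arguments.
Unset Strict Implicit.
Unset Printing Implicit Defensive.

Local Open Scope classical_set_scope.
Local Open Scope ring_scope.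

(** Let rho(x, y) = d(f x, f y)^p. Smoothness and convexity of t^p give a
    four-point inequality: the two diagonals of a quadrilateral in Y are bounded
    by one pair of opposite sides plus S^p times the other pair. When B and C are
    matched by phi, averaging it over the quadrilaterals x, y, phi x, phi y with
    x, y in B bounds the sum of rho over B x C by the mean of its sums over
    B x B and C x C, up to an error governed by a_i^p. Hence the energy, i.e. the
    sum over the blocks A of a partition of |A|^-1 times the sum of rho over
    A x A, drops by at most S^p |X| (Lip(f) a_i)^p from P^(i-1) to P^i; it is |X|
    times the mean of rho at {X} and 0 at the partition into points. This gives
    the bound without the factor 2^(1-1/p).

    In L_q, q >= 2, the same four-point inequality holds for squared distances
    with constant 2q - 2. It follows from the two-point inequality
    (|a+b|^q + |a-b|^q) / 2 <= (a^2 + (2q-2) b^2)^(q/2) and Minkowski's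
    inequality in L_(q/2). *)

(** * Bernoulli inequalities for real powers and the two-point inequality *)

Section power_inequalities.
Context {R : realType}.
Implicit Types r s t x y a b : R.

(** Young's inequality for the product of x and 1, with the conjugate exponents r and r / (r -
    1). *)
Lemma powR_Bernoulli x r : 0 <= x -> 1 <= r -> 1 + r * (x - 1) <= x `^ r.
Proof.
move=> x0; rewrite le_eqVlt => /predU1P[<-|r1]; first by rewrite powRr1//; lra.
have r0 : 0 < r by lra.
have q0 : 0 < r / (r - 1) by rewrite divr_gt0// subr_gt0.
have := @conjugate_powR _ x 1 r (r / (r - 1)) x0 ler01 r0 q0.
have rq : r^-1 + (r / (r - 1))^-1 = 1 by field; apply/andP; split; lra.
move=> /(_ rq); rewrite mulr1 powR1 div1r => h.
have -> : x `^ r = r * (x `^ r / r) by field; lra.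
have -> : 1 + r * (x - 1) = r * (x - (r / (r - 1))^-1).
  by field; apply/andP; split; lra.
by rewrite ler_pM2l// lerBlDr.
Qed.

(** The previous inequality with exponent 1/s, taken at x^s. *)
Lemma powR_Bernoulli_le1 x s : 0 <= x -> 0 <= s <= 1 ->
  x `^ s <= 1 + s * (x - 1).
Proof.
move=> x0 /andP[]; rewrite le_eqVlt => /predU1P[<- _|s0 s1].
  by rewrite powRr0 mul0r addr0.
have s1' : 1 <= s^-1 by rewrite invf_ge1.
have := powR_Bernoulli (powR_ge0 x s) s1'.
rewrite -powRrM mulfV ?gt_eqF// powRr1// => h.
have : s * (1 + s^-1 * (x `^ s - 1)) <= s * x by rewrite ler_pM2l.
by rewrite mulrDr mulrA mulfV ?gt_eqF//; lra.
Qed.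

(** Bernoulli at x/m and y/m says that t^r lies above its tangent at the midpoint m; the two linear
    terms cancel because x/m + y/m = 2. *)
Lemma powR_halfD_le x y r : 0 <= x -> 0 <= y -> 1 <= r ->
  ((x + y) / 2) `^ r <= (x `^ r + y `^ r) / 2.
Proof.
move=> x0 y0 r1.
have [m0|m0] := eqVneq ((x + y) / 2) 0.
  by rewrite m0 powR0 ?gt_eqF//; [rewrite divr_ge0 ?addr_ge0 ?powR_ge0|lra].
have {}m0 : 0 < (x + y) / 2 by rewrite lt_neqAle eq_sym m0 /=; lra.
set m := (x + y) / 2 in m0 *.
have tan z : 0 <= z -> m `^ r * (1 + r * (z / m - 1)) <= z `^ r.
  move=> z0.
  have -> : z `^ r = m `^ r * (z / m) `^ r.
    rewrite -powRM; [|exact: ltW|by rewrite divr_ge0// ltW].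
    by rewrite mulrC divfK ?gt_eqF.
  apply: ler_wpM2l; first exact: powR_ge0.
  by apply: powR_Bernoulli => //; apply: divr_ge0 => //; exact: ltW.
have := lerD (tan x x0) (tan y y0).
have xym : x / m + y / m = 2.
  have xy : x + y = m * 2 by rewrite /m divfK ?pnatr_eq0.
  by rewrite -mulrDl xy mulrAC mulfV ?mul1r ?gt_eqF.
have -> : m `^ r * (1 + r * (x / m - 1)) + m `^ r * (1 + r * (y / m - 1)) =
   m `^ r * (2 + r * (x / m + y / m - 2)) by ring.
by rewrite xym; lra.
Qed.

Let E r t := ((1 + t) `^ r + (1 - t) `^ r) / 2.

(* The two-point inequality at a and b amounts to a bound on E r t for
   t = 2 |a b| / (a ^+ 2 + b ^+ 2); it is proved for r in [1, 2] and then
   propagated from r to r + 1. *)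
Let E_base r t : 0 <= t <= 1 -> 1 <= r <= 2 ->
  E r t <= (1 + (r - 3 / 4) * t ^+ 2) `^ r.
Proof.
move=> t01 r12.
have t20 : 0 <= t ^+ 2 by rewrite sqr_ge0.
have c0 : 0 <= (r - 3 / 4) * t ^+ 2 by apply: mulr_ge0 => //; lra.
have h1 : (1 + t) `^ (r - 1) <= 1 + (r - 1) * t.
  by rewrite (le_trans (@powR_Bernoulli_le1 _ _ _ _))//; lra.
have h2 : (1 - t) `^ (r - 1) <= 1 - (r - 1) * t.
  by rewrite (le_trans (@powR_Bernoulli_le1 _ _ _ _))//; lra.
(* Split off one factor 1 + t or 1 - t from each power and bound the remaining exponent r - 1, which
   lies in [0, 1], by Bernoulli: the terms linear in t cancel. *)
have h : E r t <= 1 + (r - 1) * t ^+ 2.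
  rewrite /E -[(1 + t) `^ r]mulr_powRB1 -?[(1 - t) `^ r]mulr_powRB1; try lra.
  have t10 : 0 <= 1 + t by lra.
  have t10' : 0 <= 1 - t by lra.
  have := ler_wpM2l t10 h1; have := ler_wpM2l t10' h2.
  by lra.
apply: (le_trans h).
apply: (le_trans _ (powR_Bernoulli _ _)); try lra.
rewrite addrAC subrr add0r lerD2l mulrA ler_wpM2r//.
(* This is r - 1 <= r (r - 3/4): the quadratic r^2 - 7r/4 + 1 has negative discriminant. *)
by nra.
Qed.

Let E_step r t : 0 <= t <= 1 -> 1 <= r ->
  E r t <= (1 + (r - 3 / 4) * t ^+ 2) `^ r ->
  E (r + 1) t <= (1 + (r + 1 - 3 / 4) * t ^+ 2) `^ (r + 1).
Proof.
move=> t01 r1 IH.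
have s0 : 0 <= t ^+ 2 by rewrite sqr_ge0.
have PS z : 0 <= z -> z `^ (r + 1) = z `^ r * z.
  by move=> z0; rewrite -(@mulr_powRB1 _ z (r + 1)) ?addrK 1?mulrC//; lra.
pose s := t ^+ 2; pose u := (1 + t) `^ r; pose v := (1 - t) `^ r.
have u0 : 0 < u by apply: powR_gt0; lra.
have v0 : 0 <= v by apply: powR_ge0.
(* Bernoulli at (1 - t) / (1 + t), then t / (1 + t) <= t. *)
have uv : u - v <= 2 * r * t * u.
  have y0 : 0 <= (1 - t) / (1 + t) by apply: divr_ge0; lra.
  have -> : v = u * ((1 - t) / (1 + t)) `^ r.
    by rewrite /u -powRM//; [congr (_ `^ _); field; lra|lra].
  have B : u * (1 + r * ((1 - t) / (1 + t) - 1))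
      <= u * ((1 - t) / (1 + t)) `^ r by rewrite ler_pM2l// powR_Bernoulli.
  have : t / (1 + t) <= t.
    by rewrite ler_pdivrMr; [nra|lra].
  have BE : u * (1 + r * ((1 - t) / (1 + t) - 1)) =
     u - 2 * r * u * (t / (1 + t)) by field; lra.
  rewrite {}BE in B.
  have ru : 0 <= 2 * r * u by nra.
  by move=> /(ler_wpM2l ru); lra.
(* E (r + 1) t exceeds E r t by t (u - v) / 2, which is at most r t^2 u and hence at most r t^2 (u +
   v). *)
have step : E (r + 1) t <= E r t * (1 + 2 * r * s).
  rewrite /E !PS; try lra.
  rewrite -/u -/v.
  have rt : 0 <= 2 * r * t * v by rewrite !mulr_ge0//; lra.
  have t0 : 0 <= t by lra.
  have := ler_wpM2l t0 (le_trans uv (ler_wpDr rt (lexx _))).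
  by rewrite /s; lra.
apply: (le_trans step).
set c := r - 3 / 4 in IH *; rewrite -/s in IH *.
have c0 : 0 < 1 + c * s by rewrite ltr_pwDl// mulr_ge0// /c; lra.
have C0 : 0 <= 1 + (r + 1 - 3 / 4) * s by rewrite addr_ge0// mulr_ge0//; lra.
rewrite PS//.
have rs0 : 0 <= 1 + 2 * r * s by rewrite addr_ge0// mulr_ge0//; lra.
apply: (le_trans (ler_wpM2r rs0 IH)).
(* With this factorization (1 + c s)^r cancels from both sides, and Bernoulli applies to the r-th
   power of the quotient. What remains is polynomial in s; its linear coefficient c + 1 - r = 1/4 is
   positive by the choice of 3/4. *)
have -> : 1 + (r + 1 - 3 / 4) * s =
    (1 + c * s) * ((1 + (c + 1) * s) / (1 + c * s)).
  by rewrite [RHS]mulrC divfK ?gt_eqF// /c; ring.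
have q0 : 0 <= (1 + (c + 1) * s) / (1 + c * s).
  by apply: divr_ge0; [rewrite /c; lra|lra].
rewrite powRM// ?(ltW c0)// -[X in _ <= X]mulrA ler_wpM2l ?powR_ge0//.
have B := powR_Bernoulli q0 r1.
have W0 : 0 <= (1 + c * s) * ((1 + (c + 1) * s) / (1 + c * s)).
  by rewrite mulr_ge0// ltW.
apply: (le_trans _ (ler_wpM2r W0 B)).
set W := (X in _ <= X).
have -> : W = (1 + (c + r) * s) * (1 + (c + 1) * s) / (1 + c * s).
  by rewrite /W; field; lra.
rewrite ler_pdivlMr// -subr_ge0.
have -> : (1 + (c + r) * s) * (1 + (c + 1) * s) - (1 + 2 * r * s) * (1 + c * s)
  = s * (1 / 4) + s ^+ 2 * (5 / 4 * r - 3 / 16) by rewrite /c; field.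
by rewrite addr_ge0// mulr_ge0// ?sqr_ge0//; lra.
Qed.

Let E_le r t : 0 <= t <= 1 -> 1 <= r ->
  E r t <= (1 + (r - 3 / 4) * t ^+ 2) `^ r.
Proof.
move=> t01 r1.
have [n] : exists n : nat, r <= 2 + n%:R.
  by exists (Num.truncn r).+1; have := truncnS_gt r; lra.
elim: n r r1 => [|n IH] r r1 rn; first by apply: E_base => //; lra.
have [r2|r2] := leP r 2; first by apply: E_base => //; lra.
rewrite -[r](subrK 1); apply: E_step => //; first lra.
by apply: IH; [lra|rewrite -natr1 in rn; lra].
Qed.

(* The optimal coefficient of b ^+ 2 is q - 1; 2 * q - 2 is elementary. *)
Lemma two_point_le a b q : 2 <= q ->
  (`|a + b| `^ q + `|a - b| `^ q) / 2 <=
  (`|a| ^+ 2 + (2 * q - 2) * `|b| ^+ 2) `^ (q / 2).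
Proof.
move=> q2; rewrite !real_normK ?num_real//.
have [/eqP|s0] := eqVneq (a ^+ 2 + b ^+ 2) 0.
  rewrite paddr_eq0 ?sqr_ge0// !sqrf_eq0 => /andP[/eqP-> /eqP->].
  rewrite addr0 subr0 normr0 expr0n/= mulr0 addr0.
  by rewrite !powR0 ?addr0 ?mul0r//; lra.
have {}s0 : 0 < a ^+ 2 + b ^+ 2 by rewrite lt_neqAle eq_sym s0 addr_ge0 ?sqr_ge0.
set s := a ^+ 2 + b ^+ 2 in s0.
have sq c : `|c| `^ q = (c ^+ 2) `^ (q / 2).
  by rewrite -[c ^+ 2]real_normK ?num_real// -powR_mulrn// -powRrM mulrC divfK.
pose t := 2 * `|a * b| / s.
have t01 : 0 <= t <= 1.
  rewrite divr_ge0 ?mulr_ge0 ?(ltW s0)//= ler_pdivrMr// mul1r.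
  rewrite normrM /s -[a ^+ 2]real_normK ?num_real// -[b ^+ 2]real_normK ?num_real//.
  by have := sqr_ge0 (`|a| - `|b|); rewrite sqrrB; lra.
have r1 : 1 <= q / 2 by lra.
have [e1 e2] : 0 <= 1 + t /\ 0 <= 1 - t by lra.
(* The squares of a + b and a - b are s (1 + t) and s (1 - t), in the opposite order when a b <
   0. *)
have -> : `|a + b| `^ q + `|a - b| `^ q =
    s `^ (q / 2) * ((1 + t) `^ (q / 2) + (1 - t) `^ (q / 2)).
  rewrite !sq mulrDr -!powRM ?(ltW s0)//.
  have st : s * t = 2 * `|a * b| by rewrite /t mulrC divfK ?gt_eqF.
  rewrite mulrDr mulrBr mulr1 st.
  by have [ab|ab] := ger0P (a * b); [|rewrite addrC];
    congr (_ `^ _ + _ `^ _); rewrite /s; ring.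
rewrite -mulrA; apply: (le_trans (ler_wpM2l (powR_ge0 _ _) (E_le t01 r1))).
have p0 : 0 <= q / 2 - 3 / 4 by lra.
have w0 : 0 <= 1 + (q / 2 - 3 / 4) * t ^+ 2.
  by apply: addr_ge0 => //; apply: mulr_ge0 => //; exact: sqr_ge0.
have k0 : 0 <= (2 * q - 3) * b ^+ 2.
  by apply: mulr_ge0; [lra|exact: sqr_ge0].
rewrite -powRM ?(ltW s0)//; apply: ge0_ler_powR; first lra.
- by rewrite nnegrE; apply: mulr_ge0 => //; exact: ltW.
- by rewrite nnegrE; move: s0; rewrite /s; lra.
have a2s : a ^+ 2 / s <= 1 by rewrite ler_pdivrMr// mul1r lerDl sqr_ge0.
(* Bounding a^2 / s by 1 turns this into s + (2q - 3) b^2 = a^2 + (2q - 2) b^2, the source of the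
   constant 2q - 2. *)
have -> : s * (1 + (q / 2 - 3 / 4) * t ^+ 2) =
    s + (2 * q - 3) * b ^+ 2 * (a ^+ 2 / s).
  rewrite /t expr_div_n exprMn real_normK ?num_real// exprMn.
  by field; lra.
have := ler_wpM2l k0 a2s; rewrite /s; lra.
Qed.

End power_inequalities.

(* a, b, d, c are the consecutive vertices of a quadrilateral: ad and bc are
   its diagonals. *)
Definition four_point {R : realType} {T : Type} (K : R) (rho : T -> T -> R) :=
  forall a b c d : T,
    rho a d + rho b c <= rho a b + rho c d + K * (rho a c + rho b d).

Lemma sumr_const_natr {R : pzSemiRingType} {T : finType} (A : {pred T}) (c : R) :
  \sum_(x in A) c = c * #|A|%:R.
Proof. by rewrite sumr_const mulr_natr. Qed.

(** * Energy of partitions and its decrease along a chain of refinements *)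

Section energy.
Context {R : realType} {X : finMetricType R}.
Variables (K : R) (rho : X -> X -> R).
Hypotheses (K0 : 0 <= K) (rho4 : four_point K rho).
Implicit Types (A B C : {set X}) (P Q : {set {set X}}) (e : R).

Local Notation cross B C := (\sum_(x in B) \sum_(y in C) rho x y).

Definition energy P : R := \sum_(A in P) cross A A / #|A|%:R.

(** In the four-point inequality at x, y, phi x, phi y, the sides from x to phi x and from y to phi
    y cost at most e each. Summed over x and y in B, either diagonal gives [cross B C], as
    exchanging x and y shows. *)
Lemma cross_matched_le a e B C : matched a B C ->
  (forall x y, mdist x y <= a -> rho x y <= e) ->
  cross B C <= (cross B B + cross C C) / 2 + K * #|B|%:R ^+ 2 * e.
Proof.
move=> [phi [phi_inj phiB phia]] rhoe; subst C.
have BCE D : \sum_(x in D) \sum_(y in (phi @: B)%SET) rho x y =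
    \sum_(x in D) \sum_(y in B) rho x (phi y).
  by apply: eq_bigr => x _; rewrite big_imset.
rewrite !BCE big_imset//=.
have : \sum_(x in B) \sum_(y in B) (rho x (phi y) + rho y (phi x)) <=
    \sum_(x in B) \sum_(y in B)
      (rho x y + rho (phi x) (phi y) + K * (e + e)).
  apply: ler_sum => x xB; apply: ler_sum => y yB.
  apply: (le_trans (rho4 x y (phi x) (phi y))); rewrite lerD2l ler_wpM2l//.
  by apply: lerD; apply: rhoe; exact: phia.
have -> : \sum_(x in B) \sum_(y in B) (rho x (phi y) + rho y (phi x)) =
    2 * \sum_(x in B) \sum_(y in B) rho x (phi y).
  under eq_bigr do rewrite big_split/=.
  rewrite big_split/= [X in _ + X = _]exchange_big/=; ring.
have -> : \sum_(x in B) \sum_(y in B)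
      (rho x y + rho (phi x) (phi y) + K * (e + e)) =
    \sum_(x in B) \sum_(y in B) rho x y
    + \sum_(x in B) \sum_(y in B) rho (phi x) (phi y)
    + 2 * K * #|B|%:R ^+ 2 * e.
  under eq_bigr do rewrite big_split/= big_split/= sumr_const_natr.
  by rewrite big_split/= big_split/= sumr_const_natr; ring.
lra.
Qed.

Lemma partition_subblocks P Q A : finset.partition P [set: X]%SET ->
  finset.partition Q [set: X]%SET -> refines P Q -> A \in Q ->
  finset.partition [set B in P | B \subset A]%SET A.
Proof.
move=> /and3P[/eqP Pcov Ptriv P0] /and3P[_ Qtriv _] PQ AQ.
apply/and3P; split.
- apply/eqP/setP => x; apply/idP/idP => [/bigcupP[B]|xA].
    by rewrite inE => /andP[_ /fintype.subsetP]; exact.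
  have xP : x \in finset.cover P by rewrite Pcov inE.
  (* The block of P through x lies in some block of Q; that block shares x with A, so it is A. *)
  have [A' A'Q BA'] := PQ _ (pblock_mem xP).
  have xA' : x \in A' by apply: (fintype.subsetP BA'); rewrite mem_pblock.
  apply/bigcupP; exists (finset.pblock P x); last by rewrite mem_pblock.
  by rewrite inE pblock_mem//= -(def_pblock Qtriv AQ xA) (def_pblock Qtriv A'Q xA').
- by apply: trivIsetS Ptriv; apply/fintype.subsetP => B; rewrite inE => /andP[].
- by apply: contra P0; rewrite inE => /andP[].
Qed.

(** The matchings force all k blocks of P to have the same size m, so |A| = k m. Adding
    [cross_matched_le] over all pairs of blocks gives k times the sum of the [cross B B], plus K (k
    m)^2 e; then divide by k m. *)
Lemma energy_block_le a e P A : A != finset.set0 -> finset.partition P A ->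
  (forall B C, B \in P -> C \in P -> matched a B C) ->
  (forall x y, mdist x y <= a -> rho x y <= e) ->
  cross A A / #|A|%:R <= energy P + K * #|A|%:R * e.
Proof.
move=> A0 PA Pa rhoe.
have [B0 B0P] : exists B, B \in P.
  have /set0Pn[x] := A0; rewrite -(cover_partition PA) => /bigcupP[B ? _].
  by exists B.
have P0 := partition_neq0 PA.
pose m : nat := #|B0|; pose k : nat := #|P|.
have cardB B : B \in P -> #|B| = m.
  move=> BP; have [phi [phi_inj <- _]] := Pa _ _ B0P BP.
  by rewrite card_in_imset.
have cardA : #|A| = (k * m)%N.
  by rewrite (card_partition PA) (eq_bigr (fun=> m)) ?sum_nat_const// => B /cardB.
have m0 : 0 < m%:R :> R by rewrite ltr0n card_gt0 P0.
have k0 : 0 < k%:R :> R by rewrite ltr0n card_gt0; apply/set0Pn; exists B0.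
have -> : energy P = (\sum_(B in P) cross B B) / m%:R.
  by rewrite /energy mulr_suml; apply: eq_bigr => B /cardB ->.
have -> : cross A A = \sum_(B in P) \sum_(C in P) cross B C.
  rewrite (set_partition_big _ PA); apply: eq_bigr => B _.
  under eq_bigr do rewrite (set_partition_big _ PA).
  by rewrite exchange_big.
have le2 : \sum_(B in P) \sum_(C in P) cross B C <=
  \sum_(B in P) \sum_(C in P)
    ((cross B B + cross C C) / 2 + K * m%:R ^+ 2 * e).
  apply: ler_sum => B BP; apply: ler_sum => C CP.
  by rewrite -(cardB B BP); apply: cross_matched_le rhoe; exact: Pa.
rewrite cardA natrM ler_pdivrMr ?mulr_gt0//; apply: (le_trans le2).
under eq_bigr do rewrite big_split/= -mulr_suml big_split/= !sumr_const_natr.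
rewrite big_split/= -mulr_suml big_split/= !sumr_const_natr -/k.
rewrite le_eqVlt; apply/orP; left; apply/eqP.
rewrite -mulr_suml.
by field; rewrite gt_eqF.
Qed.

(** Each block of P lies in exactly one block A of Q, so the energy of P splits over Q; the block
    estimates then add up because the sizes |A| sum to |X|. *)
Lemma energy_refines_le a e P Q : finset.partition P [set: X]%SET ->
  finset.partition Q [set: X]%SET -> refines P Q ->
  (forall A B C, A \in Q -> B \in P -> C \in P ->
    B \subset A -> C \subset A -> matched a B C) ->
  (forall x y, mdist x y <= a -> rho x y <= e) ->
  energy Q <= energy P + K * #|X|%:R * e.
Proof.
move=> PX QX PQ Pa rhoe.
have -> : energy P = \sum_(A in Q) energy [set B in P | B \subset A]%SET.
  rewrite /energy; under [RHS]eq_bigr do under eq_bigl do rewrite inE.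
  rewrite (exchange_big_dep (mem P))/=; last by move=> ? ? _ /andP[].
  apply: eq_bigr => B BP; have [A AQ BA] := PQ _ BP.
  rewrite (big_pred1 A)// => A' /=; rewrite BP/=.
  apply/andP/eqP => [[A'Q BA']|->//].
  have /set0Pn[x xB] := partition_neq0 PX BP.
  have Qt := partition_trivIset QX.
  rewrite -(def_pblock Qt AQ (fintype.subsetP BA _ xB)).
  by rewrite -(def_pblock Qt A'Q (fintype.subsetP BA' _ xB)).
have -> : K * #|X|%:R * e = \sum_(A in Q) K * #|A|%:R * e.
  by rewrite -mulr_suml -mulr_sumr -cardsT (card_partition QX) natr_sum.
rewrite -big_split/=; apply: ler_sum => A AQ.
apply: (@energy_block_le a) => //; first exact: (partition_neq0 QX).
- exact: partition_subblocks PQ AQ.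
- by move=> B C; rewrite !inE => /andP[? ?] /andP[? ?]; apply: Pa AQ _ _ _ _.
Qed.

Lemma sum_admissible_le N (S : nat -> {set {set X}}) (a e : nat -> R) :
  admissible N S a -> (forall x, rho x x = 0) ->
  (forall i x y, (1 <= i <= N)%N -> mdist x y <= a i -> rho x y <= e i) ->
  \sum_(x : X) \sum_(y : X) rho x y
    <= #|X|%:R ^+ 2 * K * \sum_(1 <= i < N.+1) e i.
Proof.
move=> [Spart Sref S0 SN Sa] rho0 rhoe.
have [X0|X0] := posnP #|X|.
  rewrite big_pred0 ?X0 ?expr0n/= ?mul0r// => x.
  by move: (fintype.card0_eq X0 x); rewrite inE.
(* Telescoping along the chain; at i = N it compares the trivial partition with the points. The
   energy of the former carries a factor 1/|X|, whence the square of |X| in the conclusion. *)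
have en i : (i <= N)%N ->
    energy (S 0%N) <= energy (S i) + K * #|X|%:R * \sum_(1 <= j < i.+1) e j.
  elim: i => [_|i IH iN]; first by rewrite big_geq// mulr0 addr0.
  have iN1 : (1 <= i.+1 <= N)%N by [].
  have := @energy_refines_le (a i.+1) (e i.+1) _ _ (Spart _ iN)
    (Spart _ (ltnW iN)) (Sref i.+1 iN1) (Sa _ iN1).2 (fun x y => rhoe _ x y iN1).
  have := IH (ltnW iN); rewrite [\sum_(1 <= j < i.+2) e j]big_nat_recr//=; lra.
have := en N (leqnn N).
rewrite {1}/energy S0 big_set1 cardsT.
have -> : energy (S N) = 0.
  rewrite /energy SN big1// => A /imsetP[x _ ->].
  by rewrite !big_set1 rho0 mul0r.
rewrite add0r ler_pdivrMr ?ltr0n//.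
under eq_bigl do rewrite inE; under eq_bigr do under eq_bigl do rewrite inE.
by move=> h; apply: (le_trans h); rewrite le_eqVlt; apply/orP; left; apply/eqP; ring.
Qed.

End energy.

(** * Suprema over finitely many pairs, and infima *)

Lemma ler_sum_pair {R : numDomainType} {X : finType} (g : X -> X -> R) x y :
  (forall x y, 0 <= g x y) -> g x y <= \sum_(u : X) \sum_(v : X) g u v.
Proof.
move=> g0; rewrite (bigD1 x)//= (bigD1 y)//= -addrA lerDl.
by rewrite addr_ge0// !sumr_ge0// => z _; rewrite sumr_ge0.
Qed.

(** Makes the Lipschitz norms of f and its inverse real numbers: a pair satisfying P excludes -oo,
    and the total sum of g is a finite upper bound. *)
Lemma ereal_sup_pairs {R : realType} {X : finType} (P : X -> X -> Prop)
    (g : X -> X -> R) : (exists x y, P x y) -> (forall x y, 0 <= g x y) ->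
  exists2 L : R, ereal_sup [set t | exists x y, P x y /\ t = (g x y)%:E] = L%:E
    & 0 <= L /\ forall x y, P x y -> g x y <= L.
Proof.
move=> [x0 [y0 P0]] g0; set E := (X in ereal_sup X).
have ub x y : P x y -> ((g x y)%:E <= ereal_sup E)%E.
  by move=> Pxy; apply: ereal_sup_ubound; exists x, y.
have supfin : ereal_sup E \is a fin_num.
  rewrite fin_numE -ltNye -ltey.
  apply/andP; split; first exact: lt_le_trans (ltNyr _) (ub _ _ P0).
  apply: (@le_lt_trans _ _ (\sum_(x : X) \sum_(y : X) g x y)%:E); last exact: ltry.
  apply: ge_ereal_sup => _ [x [y [_ ->]]]; rewrite lee_fin.
  exact: ler_sum_pair.
exists (fine (ereal_sup E)); first by rewrite fineK.
split; last by move=> x y Pxy; rewrite -lee_fin fineK// ub.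
by rewrite fine_ge0// (le_trans _ (ub _ _ P0))// lee_fin.
Qed.

Lemma le_mul_inf {R : realType} (E : set R) (c D : R) : 0 <= c -> E !=set0 ->
  (forall l, E l -> D <= c * l) -> D <= c * inf E.
Proof.
rewrite le_eqVlt => /predU1P[<-|c0] E0 EP.
  by have [l El] := E0; have := EP l El; rewrite !mul0r.
rewrite -ler_pdivrMl//; apply: lb_le_inf => // l El.
by rewrite ler_pdivrMl// EP.
Qed.

(** * Distortion of a single map into a space with a four-point inequality *)

Section distortion_bound.
Context {R : realType} {X : finMetricType R}.
Definition mean_dist (p : R) : R :=
  ((#|X|%:R ^+ 2)^-1 * \sum_(x : X) \sum_(y : X) mdist x y `^ p) `^ p^-1.

Hypothesis X2 : (2 <= #|X|)%N.

Let X_neq : exists x y : X, x != y.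
Proof.
have /card_gt1P[x [y [_ _ xy]]] : (1 < #|[set: X]%SET|)%N by rewrite cardsT.
by exists x, y.
Qed.

Lemma mean_dist_gt0 p : 0 < mean_dist p.
Proof.
have [x [y xy]] := X_neq.
apply: powR_gt0; rewrite mulr_gt0// ?invr_gt0 ?exprn_gt0 ?ltr0n ?(ltnW X2)//.
apply: (@lt_le_trans _ _ (mdist x y `^ p)); first by rewrite powR_gt0// mdist_gt0.
apply: (@ler_sum_pair R X (fun x y => mdist x y `^ p)) => u v.
exact: powR_ge0.
Qed.

(** Ensures that the infimum defining [lp_length] runs over a nonempty set. The chain is one step
    from {X} to the points. *)
Lemma admissible_exists : exists N (P : nat -> {set {set X}}) a, admissible N P a.
Proof.
pose P (i : nat) : {set {set X}} :=
  if i is 0%N then [set [set: X]%SET]%SET else [set [set x]%SET | x : X]%SET.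
(* The sum dominates every distance, and the 1 makes a positive. *)
pose a : R := 1 + \sum_(x : X) \sum_(y : X) mdist x y.
have da (x y : X) : mdist x y <= a.
  rewrite ler_wpDl//; apply: (@ler_sum_pair R X (fun x y => mdist x y)) => u v.
  exact: mdist_ge0.
have s1P (B : {set X}) :
    reflect (exists x, B = [set x]%SET) (B \in [set [set x]%SET | x : X]%SET).
  by apply: (iffP imsetP) => [[x _ ->]|[x ->]]; exists x.
exists 1%N, P, (fun=> a); split => //.
- move=> [_|[_|//]].
  + apply/and3P; split.
    * by rewrite /finset.cover big_set1.
    * by apply/finset.trivIsetP => A B; rewrite !inE => /eqP-> /eqP->; rewrite eqxx.
    * rewrite inE eq_sym; apply/set0Pn; have [x _] := X_neq.
      by exists x; rewrite inE.
  + apply/and3P; split.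
    * apply/eqP/setP => x; rewrite inE; apply/bigcupP.
      by exists [set x]%SET; [apply/s1P; exists x|rewrite inE].
    * apply/finset.trivIsetP => A B /s1P[x ->] /s1P[y ->] xy.
      by rewrite disjoints1 inE; apply: contraNN xy => /eqP ->.
    * by apply/negP => /s1P[x] /setP/(_ x); rewrite !inE eqxx.
- move=> [//|[_|//]] B _; exists [set: X]%SET; first by rewrite /= inE.
  exact: finset.subsetT.
- move=> [//|[_|//]]; split.
    rewrite ltr_pwDl// sumr_ge0// => x _; rewrite sumr_ge0// => *.
    exact: mdist_ge0.
  move=> A B C _ /s1P[x ->] /s1P[y ->] _ _; exists (fun=> y); split => //.
  + by move=> u v; rewrite !inE => /eqP -> /eqP ->.
  + by rewrite imset_set1.
Qed.

(** Apply the energy bound to the p-th powers of the image distances: the Lipschitz norm L of f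
    bounds them by (L a_i)^p at scale a_i, and the norm M of the inverse recovers d from them. The
    bound is kept as a product, since later the positivity of its factors is read off from it. *)
Lemma mean_dist_le (p S : R) (Y : metricType R) (f : X -> Y) : 1 <= p ->
  0 <= S -> four_point (S `^ p) (fun x y : Y => mdist x y `^ p) ->
  injective f ->
  exists2 A, distortion f = A%:E & 0 <= A /\ mean_dist p <= S * A * lp_length p X.
Proof.
move=> p1 S0 Y4 finj.
have p0 : 0 < p by lra.
have [L LE [L0 Lf]] := ereal_sup_pairs X_neq (fun x y =>
  divr_ge0 (mdist_ge0 (f x) (f y)) (mdist_ge0 x y)).
have fX_neq : exists x y : X, f x != f y.
  by have [x [y xy]] := X_neq; exists x, y; rewrite (inj_eq finj).
have [M ME [M0 Mf]] := ereal_sup_pairs fX_neq (fun x y =>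
  divr_ge0 (mdist_ge0 x y) (mdist_ge0 (f x) (f y))).
exists (L * M).
  by rewrite /distortion asboolT// /lip_norm /inv_lip_norm LE ME EFinM.
split; first exact: mulr_ge0.
have fL x y : mdist (f x) (f y) <= L * mdist x y.
  have [->|xy] := eqVneq x y; first by rewrite !mdistxx mulr0.
  by rewrite -ler_pdivrMr ?mdist_gt0// Lf.
have fM x y : mdist x y <= M * mdist (f x) (f y).
  have [->|xy] := eqVneq x y; first by rewrite !mdistxx mulr0.
  by rewrite -ler_pdivrMr ?mdist_gt0 ?Mf// (inj_eq finj).
have n0 : 0 < #|X|%:R ^+ 2 :> R by rewrite exprn_gt0// ltr0n (ltnW X2).
apply: le_mul_inf; first by rewrite !mulr_ge0.
  by have [N [P [a aP]]] := admissible_exists; eexists; exists N, P, a.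
move=> _ [N [P [a [aP ->]]]].
have a0 i : (1 <= i <= N)%N -> 0 < a i by case: aP => _ _ _ _ h /h[].
have rho4 : four_point (S `^ p) (fun x y : X => mdist (f x) (f y) `^ p).
  by move=> x y z t; exact: Y4.
have rhoe i x y : (1 <= i <= N)%N -> mdist x y <= a i ->
    mdist (f x) (f y) `^ p <= L `^ p * a i `^ p.
  move=> iN xy; have ai0 := ltW (a0 _ iN); rewrite -powRM//.
  apply: ge0_ler_powR; rewrite ?nnegrE ?(ltW p0) ?mdist_ge0 ?mulr_ge0//.
  by apply: (le_trans (fL x y)); rewrite ler_wpM2l.
have rho0 x : mdist (f x) (f x) `^ p = 0 by rewrite mdistxx powR0// gt_eqF.
have Hsum := sum_admissible_le (powR_ge0 S p) rho4 aP rho0 rhoe.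
set s := \sum_(1 <= i < N.+1) _.
have s0 : 0 <= s by rewrite sumr_ge0// => i _; exact: powR_ge0.
have -> : S * (L * M) * s `^ p^-1 = ((S * (L * M)) `^ p * s) `^ p^-1.
  rewrite powRM ?powR_ge0// -powRrM mulfV ?gt_eqF// powRr1//.
  by rewrite !mulr_ge0.
apply: ge0_ler_powR; rewrite ?nnegrE ?invr_ge0 ?(ltW p0)//.
- rewrite mulr_ge0 ?invr_ge0 ?(ltW n0)// sumr_ge0// => x _.
  by rewrite sumr_ge0// => y _; exact: powR_ge0.
- by rewrite mulr_ge0 ?powR_ge0.
rewrite ler_pdivrMl//.
apply: (@le_trans _ _ (M `^ p * \sum_(x : X) \sum_(y : X) mdist (f x) (f y) `^ p)).
  rewrite mulr_sumr; apply: ler_sum => x _; rewrite mulr_sumr.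
  apply: ler_sum => y _; rewrite -powRM ?mdist_ge0//.
  by apply: ge0_ler_powR; rewrite ?nnegrE ?(ltW p0) ?mulr_ge0 ?mdist_ge0.
apply: (le_trans (ler_wpM2l (powR_ge0 M p) Hsum)).
rewrite -mulr_sumr -/s !powRM ?mulr_ge0//.
by rewrite le_eqVlt; apply/orP; left; apply/eqP; ring.
Qed.

End distortion_bound.

Arguments mean_dist {R} X p.

(** * The four-point inequality in a p-smooth space *)

Lemma addr_diagonals (V : zmodType) (a b c d : V) :
  a - b + (c - d) + (a - c + (b - d)) = (a - d) *+ 2 /\
  a - b + (c - d) - (a - c + (b - d)) = (c - b) *+ 2.
Proof.
split; first by rewrite [a - c + _]addrC addrACA [c - d + _]addrC !subrKA.
by rewrite opprD !opprB addrACA [a - b + _]addrC !subrKA.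
Qed.

Lemma p_smooth_four_point {R : realType} (p S : R) (Y : completeNormedModType R) :
  1 <= p -> p_smooth_with p Y S ->
  four_point (S `^ p) (fun x y : normed_metric Y => mdist x y `^ p).
Proof.
move=> p1 smooth a b c d.
have mdistE (x y : normed_metric Y) : mdist x y = `|(x : Y) - (y : Y)| by [].
rewrite !mdistE; move: (a : Y) (b : Y) (c : Y) (d : Y) => {}a {}b {}c {}d.
have half (u v : Y) : `|2^-1 *: (u + v)| `^ p <= (`|u| `^ p + `|v| `^ p) / 2.
  apply: (le_trans _ (powR_halfD_le (normr_ge0 u) (normr_ge0 v) p1)).
  have uv : `|2^-1 *: (u + v)| <= (`|u| + `|v|) / 2.
    by rewrite normrZ gtr0_norm ?invr_gt0// mulrC ler_pM2r ?invr_gt0// ler_normD.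
  have uv0 := le_trans (normr_ge0 _) uv.
  by apply: ge0_ler_powR; rewrite ?nnegrE//; lra.
(* Smoothness is applied to the half-sums of the two pairs of opposite sides; their sum and
   difference are the diagonals a - d and c - b, and [half] bounds their norms by convexity. *)
have := smooth (2^-1 *: ((a - b) + (c - d))) (2^-1 *: ((a - c) + (b - d))).
have [diagD diagB] := addr_diagonals a b c d.
rewrite -scalerDr -scalerBr diagD diagB.
rewrite -[(a - d) *+ 2]scaler_nat -[(c - b) *+ 2]scaler_nat.
rewrite !scalerA mulVf ?pnatr_eq0//.
rewrite !scale1r [`|c - b|]distrC => h; apply: (le_trans h).
have := half (a - b) (c - d).
have := ler_wpM2l (powR_ge0 S p) (half (a - c) (b - d)); lra.
Qed.

(** * Lower bounds for the least distortion *)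

Section least_distortion_bounds.
Context {R : realType} {X : finMetricType R}.
Hypothesis X2 : (2 <= #|X|)%N.

Lemma lp_length_ge0 p : 0 <= lp_length p X.
Proof.
have [N [P [a aP]]] := admissible_exists X2.
apply: lb_le_inf; first by eexists; exists N, P, a.
by move=> _ [? [? [? [_ ->]]]]; exact: powR_ge0.
Qed.

Lemma least_distortion_ge (p S : R) (Y : metricType R) : 1 <= p ->
  0 <= S -> four_point (S `^ p) (fun x y : Y => mdist x y `^ p) ->
  (((lp_length p X * S)^-1 * mean_dist X p)%:E <= least_distortion Y X)%E.
Proof.
move=> p1 S0 Y4; apply: le_ereal_inf_tmp => _ [f _ <-].
have [finj|/asboolPn fninj] := pselect (injective f); last first.
  by rewrite /distortion (negbTE fninj) leey.
have [A -> [A0 DA]] := mean_dist_le X2 p1 S0 Y4 finj.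
have D0 := mean_dist_gt0 X2 p; have l0 := lp_length_ge0 p.
rewrite lee_fin.
(* A zero product would contradict [DA], as the mean distance is positive. *)
have lS : 0 < lp_length p X * S.
  rewrite lt_neqAle mulr_ge0// andbT eq_sym; apply/eqP => lS.
  by move: DA; rewrite mulrAC [S * _]mulrC lS mul0r leNgt D0.
by rewrite ler_pdivrMl// (le_trans DA)// le_eqVlt; apply/orP; left; apply/eqP; ring.
Qed.

Lemma least_distortion_p_smooth (p : R) (Y : completeNormedModType R) :
  1 <= p -> p_smooth p Y ->
  (((2 `^ (1 - p^-1))%:E * p_smooth_const p Y * (lp_length p X)%:E)^-1
   * (mean_dist X p)%:E <= least_distortion (normed_metric Y) X)%E.
Proof.
move=> p1 Yp; apply: le_ereal_inf_tmp => _ [f _ <-].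
have [finj|/asboolPn fninj] := pselect (injective f); last first.
  by rewrite /distortion (negbTE fninj) leey.
have D0 := mean_dist_gt0 X2 p.
have [S0 S0in] : exists S : R, 0 <= S /\ p_smooth_with p Y S.
  apply: contrapT => noS; move: Yp; rewrite /p_smooth /p_smooth_const.
  suff -> : [set S%:E | S in [set S : R | 0 <= S /\ p_smooth_with p Y S]] = set0.
    by rewrite ereal_inf0 ltxx.
  by apply/seteqP; split => // x [S SP _]; case: noS; exists S.
have [A fA [A0 _]] := mean_dist_le X2 p1 S0in.1 (p_smooth_four_point p1 S0in.2) finj.
have DA S : 0 <= S -> p_smooth_with p Y S -> mean_dist X p <= S * A * lp_length p X.
  move=> S0' Sin.
  have [A' fA' []] := mean_dist_le X2 p1 S0' (p_smooth_four_point p1 Sin) finj.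
  by move: fA'; rewrite fA => -[<-].
(* The bound obtained has no factor 2^(1 - 1/p); as this factor is at least 1, inserting it only
   weakens the bound. *)
have c1 : 1 <= 2 `^ (1 - p^-1) :> R.
  rewrite -[leLHS](powRr0 2); apply: ler_powR; first by rewrite ler1n.
  by rewrite subr_ge0 invf_le1; lra.
have lA : 0 <= A * lp_length p X by rewrite mulr_ge0 ?lp_length_ge0.
have [s sE] : exists s, p_smooth_const p Y = s%:E.
  exists (fine (p_smooth_const p Y)); rewrite fineK// ge0_fin_numE//.
  rewrite /p_smooth_const; apply: le_ereal_inf_tmp => _ [S [S0' _] <-].
  by rewrite lee_fin.
(* For this fixed f, pass to the infimum over all smoothness constants S. If A times the length is
   0, a single S already gives the claim. *)
have Ds : mean_dist X p <= s * (A * lp_length p X).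
  have [lA0|lA0] := eqVneq (A * lp_length p X) 0.
    by have := DA _ S0in.1 S0in.2; rewrite -mulrA lA0 !mulr0.
  have {lA0}lA0 : 0 < A * lp_length p X by rewrite lt_neqAle eq_sym lA0.
  rewrite -ler_pdivrMr// -lee_fin -sE /p_smooth_const.
  apply: le_ereal_inf_tmp => _ [S [S0' SP] <-].
  by rewrite lee_fin ler_pdivrMr// mulrA DA.
have s0 : 0 <= s.
  rewrite -lee_fin -sE /p_smooth_const.
  apply: le_ereal_inf_tmp => _ [S [S0' _] <-].
  by rewrite lee_fin.
have l0 := lp_length_ge0 p.
have sl : 0 < s * lp_length p X.
  rewrite lt_neqAle mulr_ge0// andbT eq_sym; apply/eqP => sl.
  by move: Ds; rewrite mulrCA sl mulr0 leNgt D0.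
have csl : 0 < 2 `^ (1 - p^-1) * s * lp_length p X.
  by rewrite -mulrA mulr_gt0// (lt_le_trans _ c1).
rewrite fA sE -!EFinM inver gt_eqF// -EFinM lee_fin ler_pdivrMl//.
apply: (le_trans Ds).
rewrite [s * _]mulrCA -[_ * s * _]mulrA [X in _ <= X]mulrC ler_wpM2l//.
by rewrite ler_peMl// ltW.
Qed.

End least_distortion_bounds.

(** * Norm inequalities in L_q for q >= 2 *)

Section Lnorm_smoothness.
Context {d : measure_display} {T : measurableType d} {R : realType}.
Variables (mu : {measure set T -> \bar R}) (q : R).
Hypothesis q2 : 2 <= q.
Implicit Types (f g : T -> R) (F G : R).

Let q0 : q != 0. Proof. by rewrite gt_eqF// (lt_le_trans _ q2). Qed.

Let N f := ('N[mu]_(q%:E) [EFin \o f])%E.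

Let integral_powR f F : N f = F%:E ->
  (\int[mu]_x (`|f x| `^ q)%:E = (F `^ q)%:E)%E.
Proof. by move=> NF; rewrite -poweR_EFin -NF poweR_Lnorm. Qed.

Let Lnorm_sqr c f F : measurable_fun [set: T] f -> 0 <= c -> 0 <= F -> N f = F%:E ->
  ('N[mu]_((q / 2)%:E) [EFin \o (fun x => c * `|f x| ^+ 2)%R] = (c * F ^+ 2)%:E)%E.
Proof.
move=> mf c0 F0 NF; rewrite unlock/=.
have r0 : q / 2 != 0 by rewrite mulf_neq0 ?invr_eq0 ?pnatr_eq0.
under eq_integral => x _.
  rewrite ger0_norm ?mulr_ge0 ?exprn_ge0// powRM ?exprn_ge0//.
  rewrite -powR_mulrn// -powRrM [2 * _]mulrC divfK// EFinM.
  over.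
rewrite ge0_integralZl_EFin ?powR_ge0//; last first.
  apply/measurable_EFinP; apply: (@measurableT_comp _ _ _ _ _ _ (@powR R ^~ q)) => //.
  exact: measurableT_comp.
rewrite (integral_powR NF) -EFinM poweR_EFin powRM ?powR_ge0// -!powRrM.
rewrite mulfV// powRr1//.
by have -> : q / (q / 2) = 2%:R; [field|rewrite powR_mulrn].
Qed.

Lemma Lnorm_scale c f F : measurable_fun [set: T] f -> 0 <= c -> 0 <= F ->
  N f = F%:E -> N (fun x => c * f x) = (c * F)%:E.
Proof.
move=> mf c0 F0 NF; rewrite /N unlock/=.
under eq_integral => x _.
  rewrite normrM (ger0_norm c0) powRM// EFinM.
  over.
rewrite ge0_integralZl_EFin ?powR_ge0//; last first.
  apply/measurable_EFinP; apply: (@measurableT_comp _ _ _ _ _ _ (@powR R ^~ q)) => //.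
  exact: measurableT_comp.
rewrite (integral_powR NF) -EFinM poweR_EFin powRM ?powR_ge0// -!powRrM.
by rewrite mulfV// !powRr1.
Qed.

(** Integrating the pointwise inequality bounds (U^q + V^q) / 2 by the integral of (h1 + h2)^(q/2),
    and Minkowski in L_(q/2) bounds that by (F^2 + (2q - 2) G^2)^(q/2). Convexity of t^(q/2) at U^2
    and V^2 bounds the left side from below. *)
Lemma Lnorm_two_point f g F G U V :
  measurable_fun [set: T] f -> measurable_fun [set: T] g ->
  0 <= F -> 0 <= G -> 0 <= U -> 0 <= V ->
  N f = F%:E -> N g = G%:E -> N (f \+ g) = U%:E -> N (f \- g) = V%:E ->
  U ^+ 2 + V ^+ 2 <= 2 * F ^+ 2 + 2 * (2 * q - 2) * G ^+ 2.
Proof.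
move=> mf mg F0 G0 U0 V0 NF NG NU NV.
have c0 : 0 <= 2 * q - 2 by have := q2; lra.
have r1 : 1 <= q / 2 by have := q2; lra.
have r0 : 0 < q / 2 by have := q2; lra.
pose h1 x := 1 * `|f x| ^+ 2; pose h2 x := (2 * q - 2) * `|g x| ^+ 2.
have msqr k (h : T -> R) : measurable_fun [set: T] h ->
    measurable_fun [set: T] (fun x => k * `|h x| ^+ 2).
  move=> mh; apply: measurable_funM => //.
  by apply: measurable_funX; exact: measurableT_comp.
have mpow (h : T -> R) r : measurable_fun [set: T] h ->
    measurable_fun [set: T] (fun x => (`|h x| `^ r)%:E).
  move=> mh; apply/measurable_EFinP.
  apply: (@measurableT_comp _ _ _ _ _ _ (@powR R ^~ r)) => //.
  exact: measurableT_comp.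
have mink : ('N[mu]_((q / 2)%:E) [EFin \o (h1 \+ h2)%R]
    <= (F ^+ 2 + (2 * q - 2) * G ^+ 2)%:E)%E.
  apply: (le_trans (minkowski_EFin _ _ _ _)); [exact: msqr|exact: msqr|exact: r1|].
  by rewrite (Lnorm_sqr mf ler01 F0 NF) (Lnorm_sqr mg c0 G0 NG) -EFinD mul1r.
have intle : ((2^-1 * (U `^ q + V `^ q))%:E <=
    \int[mu]_x (`|h1 x + h2 x| `^ (q / 2))%:E)%E.
  rewrite EFinM EFinD -(integral_powR NU) -(integral_powR NV).
  rewrite -ge0_integralD//; try (by move=> x _; rewrite lee_fin powR_ge0); last 2 first.
  - by apply: mpow; exact: measurable_funD.
  - by apply: mpow; exact: measurable_funB.
  rewrite -ge0_integralZl_EFin//; last 2 first.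
  - by move=> x _; rewrite -EFinD lee_fin addr_ge0 ?powR_ge0.
  - apply: emeasurable_funD; apply: mpow; first exact: measurable_funD.
    exact: measurable_funB.
  apply: ge0_le_integral => //.
  - by move=> x _; rewrite -EFinD -EFinM lee_fin mulr_ge0 ?addr_ge0 ?powR_ge0.
  - apply: measurable_funeM; apply: emeasurable_funD; apply: mpow.
      exact: measurable_funD.
    exact: measurable_funB.
  - by apply: (mpow (h1 \+ h2)); apply: measurable_funD; exact: msqr.
  - move=> x _; rewrite -EFinD -EFinM lee_fin mulrC.
    have h0 : 0 <= h1 x + h2 x by rewrite addr_ge0 ?mulr_ge0 ?exprn_ge0.
    by rewrite (ger0_norm h0) /h1 mul1r; exact: two_point_le.
have key : 2^-1 * (U `^ q + V `^ q) <= (F ^+ 2 + (2 * q - 2) * G ^+ 2) `^ (q / 2).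
  rewrite -lee_fin (le_trans intle)// -poweR_EFin.
  have -> : (\int[mu]_x (`|h1 x + h2 x| `^ (q / 2))%:E =
      'N[mu]_((q / 2)%:E) [EFin \o (h1 \+ h2)%R] `^ (q / 2))%E.
    by rewrite poweR_Lnorm ?gt_eqF.
  apply: gt0_ler_poweR => //; first exact: ltW.
  - by rewrite in_itv/= Lnorm_ge0 leey.
  - by rewrite in_itv/= leey andbT lee_fin addr_ge0 ?mulr_ge0 ?exprn_ge0.
have sq w : 0 <= w -> w `^ q = (w ^+ 2) `^ (q / 2).
  by move=> w0; rewrite -powR_mulrn// -powRrM mulrC divfK.
rewrite sq// [V `^ q]sq// mulrC in key.
have := le_trans (powR_halfD_le (sqr_ge0 U) (sqr_ge0 V) r1) key.
(* The exponent q/2 is removed by strict monotonicity, through the contrapositive. *)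
rewrite leNgt => /negP h; rewrite leNgt; apply/negP => lt; apply: h.
apply: gt0_ltr_powR; rewrite ?nnegrE//.
- by rewrite addr_ge0 ?mulr_ge0 ?exprn_ge0.
- by rewrite divr_ge0 ?addr_ge0 ?exprn_ge0.
- by rewrite ltr_pdivlMr//; move: lt; lra.
Qed.

End Lnorm_smoothness.

(** The argument for p-smooth spaces with p = 2, where [Lnorm_two_point] replaces smoothness; the
    square root puts 2q - 2 into the form S^p. *)
Lemma Lspace_four_point {d : measure_display} {T : measurableType d} {R : realType}
    (mu : {measure set T -> \bar R}) (q : R) (q1 : (1 <= q%:E)%E) : 2 <= q ->
  four_point (Num.sqrt (2 * q - 2) `^ 2)
    (fun f g : LspaceType mu q1 => mdist f g `^ 2).
Proof.
move=> q2 a b c d0.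
have K0 : 0 <= 2 * q - 2 by lra.
pose N (f : T -> R) := ('N[mu]_(q%:E) [EFin \o f])%E.
have mL (f : LspaceType mu q1) : measurable_fun [set: T] (f : T -> R).
  exact: (measurable_funPT (repr (LebesgueSpace.sort f))).
have NB (f g : LspaceType mu q1) :
    N ((f : T -> R) \- (g : T -> R)) = (mdist f g)%:E.
  rewrite /mdist/= /Lspace_dist fineK// ge0_fin_numE ?Lnorm_ge0//.
  rewrite (_ : _ \- _ = (f : T -> R) \+ (\- (g : T -> R)))//.
  apply: le_lt_trans (eminkowski mu _ _ q1) _ => //.
    exact: measurableT_comp.
  rewrite (_ : EFin \o (\- (g : T -> R)) = (\- (EFin \o (g : T -> R)))%E)//.
  rewrite oppe_Lnorm.
  by apply: lte_add_pinfty; exact: Lebesgue_finite.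
(* Minkowski's inequality followed by (s + t)^2 <= 2 (s^2 + t^2). *)
have half_norm (f g h k : LspaceType mu q1) (u : T -> R) :
    u = (fun x => 2^-1 * ((f x - g x) + (h x - k x))) ->
    measurable_fun [set: T] u /\
    exists2 F, N u = F%:E & 0 <= F /\ 2 * F ^+ 2 <= mdist f g ^+ 2 + mdist h k ^+ 2.
  move=> ->; pose v : T -> R := (f \- g) \+ (h \- k).
  have mv : measurable_fun [set: T] v.
    by apply: measurable_funD; apply: measurable_funB; exact: mL.
  have Nv : (N v <= (mdist f g + mdist h k)%:E)%E.
    rewrite EFinD -!NB; apply: (minkowski_EFin _ _ _ _); last by lra.
    - by apply: measurable_funB; exact: mL.
    - by apply: measurable_funB; exact: mL.
  have Nvf : N v = (fine (N v))%:E.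
    by rewrite fineK// ge0_fin_numE ?Lnorm_ge0// (le_lt_trans Nv)// ltry.
  have Nv0 : 0 <= fine (N v) by rewrite fine_ge0// Lnorm_ge0.
  split; first exact: measurable_funM.
  exists (2^-1 * fine (N v)); first exact: Lnorm_scale.
  split; first by rewrite mulr_ge0.
  have := Nv; rewrite Nvf lee_fin => le.
  have := sqr_ge0 (mdist f g - mdist h k).
  have : fine (N v) ^+ 2 <= (mdist f g + mdist h k) ^+ 2.
    by rewrite ler_sqr ?nnegrE ?(le_trans Nv0).
  rewrite sqrrB sqrrD exprMn; lra.
have [mf [F NF [F0 Fle]]] := half_norm a b c d0 _ erefl.
have [mg [G NG [G0 Gle]]] := half_norm a c b d0 _ erefl.
have := @Lnorm_two_point _ T R mu q q2 _ _ F G (mdist a d0) (mdist c b) mf mg F0 G0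
  (mdist_ge0 _ _) (mdist_ge0 _ _) NF NG.
(* The sum and difference of the two half-sums are a - d0 and c - b. *)
rewrite -!NB => /(_ _ _)/wrap[].
- by apply: eq_Lnorm => x /=; congr EFin; field.
- by apply: eq_Lnorm => x /=; congr EFin; field.
rewrite !powR_mulrn ?mdist_ge0 ?sqrtr_ge0// sqr_sqrtr// [mdist c b]metric_sym.
have := ler_wpM2l K0 Gle; lra.
Qed.

Theorem theorem6p2 (R : realType) (X : finMetricType R) (X2 : (2 <= #|X|)%N) :
  (forall (p : R) (Y : completeNormedModType R),
    1 <= p <= 2 -> p_smooth p Y ->
    (((2 `^ (1 - p^-1))%:E * p_smooth_const p Y * (lp_length p X)%:E)^-1
     * (((#|X|%:R ^+ 2)^-1 * \sum_(x : X) \sum_(y : X) mdist x y `^ p)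
          `^ p^-1)%:E
     <= least_distortion (normed_metric Y) X)%E)
  /\
  (forall (q : R) (q1 : (1 <= q%:E)%E),
    2 <= q ->
    (((lp_length 2 X * Num.sqrt (2 * q - 2))^-1
      * Num.sqrt ((#|X|%:R ^+ 2)^-1
                  * \sum_(x : X) \sum_(y : X) mdist x y ^+ 2))%:E
     <= least_distortion (Lq01 q1) X)%E).
Proof.
have one_le2 : 1 <= 2 :> R by rewrite ler1n.
split=> [p Y /andP[p1 _] Yp|q q1 q2]; first exact: least_distortion_p_smooth.
have := least_distortion_ge X2 one_le2 (sqrtr_ge0 _)
  (@Lspace_four_point _ _ _ (mrestr lebesgue_measure (measurable_itv `[0, 1])) q q1 q2).
rewrite /mean_dist powR12_sqrt; last first.
  rewrite mulr_ge0 ?invr_ge0 ?exprn_ge0// sumr_ge0// => x _.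
  by rewrite sumr_ge0// => y _; exact: powR_ge0.
under [X in Num.sqrt (_ * X)]eq_bigr do
  under eq_bigr do rewrite powR_mulrn ?mdist_ge0//.
exact.
Qed.
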